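(* Let $(M,g)$ be a tangential hypersurface, with unit normal vector field $N$, of a locally product-like statistical manifold $(\widetilde{M},\widetilde{g},\widetilde{\nabla},F)$. Then for all $X,Y\in\Gamma(TM)$: $$\eta((\overline{\nabla}^{\ast}_{X}A^{\ast})_{N}Y)-\eta((\overline{\nabla}^{\ast}_{Y}A^{\ast})_{N}X)=-\eta^{\ast}((\overline{\nabla}_{X}A)_{N}Y)+\eta^{\ast}((\overline{\nabla}_{Y}A)_{N}X).$$
   Context: A statistical manifold $(\widetilde{M},\widetilde{g},\widetilde{\nabla})$ is a Riemannian manifold with a torsion-free affine connection $\widetilde{\nabla}$ such that $\widetilde{\nabla}\widetilde{g}$ is totally symmetric. The dual connection $\widetilde{\nabla}^{\ast}$ is defined by $Z\widetilde{g}(X,Y)=\widetilde{g}(X,\widetilde{\nabla}^{\ast}_{Z}Y)+\widetilde{g}(\widetilde{\nabla}_{Z}X,Y)$; it is also torsion-free. A locally product-like statistical manifold $(\widetilde{M},\widetilde{g},\widetilde{\nabla},F)$ is a statistical manifold with a $(1,1)$-tensor field $F$ satisfying $F^{2}=I$ and $\widetilde{\nabla}F=0$, together with the $(1,1)$-tensor field $F^{\ast}$ satisfying $\widetilde{g}(FX,Y)=\widetilde{g}(X,F^{\ast}Y)$. A hypersurface $(M,g)$ (induced metric $g$, unit normal $N$) is tangential if $FN$ and $F^{\ast}N$ are tangent to $M$. Then put $\xi=FN$, $\xi^{\ast}=F^{\ast}N$, $\eta(X)=g(X,\xi)$ and $\eta^{\ast}(X)=g(X,\xi^{\ast})$ for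 $X\in\Gamma(TM)$. The Gauss and Weingarten formulas, for $X,Y\in\Gamma(TM)$, are $$\widetilde{\nabla}_{X}Y=\nabla_{X}Y+g(A^{\ast}_{N}X,Y)N,\quad \widetilde{\nabla}_{X}N=-A_{N}X+\kappa(X)N,$$ $$\widetilde{\nabla}^{\ast}_{X}Y=\nabla^{\ast}_{X}Y+g(A_{N}X,Y)N,\quad \widetilde{\nabla}^{\ast}_{X}N=-A^{\ast}_{N}X-\kappa(X)N,$$ which define the induced connections $\nabla,\nabla^{\ast}$ on $M$, the shape operators $A_{N},A^{\ast}_{N}$ and the $1$-form $\kappa$ on $M$. Moreover $$(\overline{\nabla}_{X}A)_{N}Y=\nabla_{X}(A_{N}Y)-\kappa(X)A_{N}Y-A_{N}(\nabla_{X}Y),$$ $$(\overline{\nabla}^{\ast}_{X}A^{\ast})_{N}Y=\nabla^{\ast}_{X}(A^{\ast}_{N}Y)+\kappa(X)A^{\ast}_{N}Y-A^{\ast}_{N}(\nabla^{\ast}_{X}Y).$$ *)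

(* Defs.v *)
From HB Require Import structures.
From mathcomp Require Import all_boot all_order all_algebra.
From mathcomp Require Import all_classical all_reals all_analysis.
Set Implicit Arguments.
Unset Strict Implicit.
Unset Printing Implicit Defensive.
Import Order.TTheory GRing.Theory Num.Theory.
Import numFieldNormedType.Exports.
Local Open Scope classical_set_scope.
Local Open Scope ring_scope.

(* MathComp-Analysis has no manifolds; the smooth category is set up below in  *)
(* the style of Lean's mathlib: every point carries a preferred chart, and the *)
(* tangent space at p is the model space R^n, a vector being identified with   *)
(* its components in the preferred chart at p.                                 *)
(*                                                                             *)
(* Fields (functions, vector fields, ...) are total functions on the manifold; *)
(* "smooth at p" always means smooth on a neighbourhood of p, so that a local  *)
(* section on an open set U is a total function that is smooth at every point  *)
(* of U. A section is globally smooth when it is smooth at every point.        *)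

Section SmoothCalculus.
Context {R : realType} {V W : normedModType R}.

Fixpoint Ck (k : nat) (U : set V) (f : V -> W) : Prop :=
  if k is k'.+1 then
    (forall x, U x -> differentiable f x) /\
    (forall v : V, Ck k' U (fun x => 'd f x v))
  else forall x, U x -> {for x, continuous f}.

Definition smooth_on (U : set V) (f : V -> W) : Prop := forall k, Ck k U f.

Definition smooth_at (f : V -> W) (x : V) : Prop :=
  exists2 U : set V, open_nbhs x U & smooth_on U f.

End SmoothCalculus.

Record chart (R : realType) (n : nat) (T : topologicalType) := Chart {
  chart_dom : set T;
  chart_map :> T -> 'rV[R]_n;
  chart_inv : 'rV[R]_n -> T;
  chart_dom_open : open chart_dom;
  chart_img_open : open (chart_map @` chart_dom);
  chart_mapK : forall p, chart_dom p -> chart_inv (chart_map p) = p;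
  chart_map_cont : forall p, chart_dom p -> {for p, continuous chart_map};
  chart_inv_cont : forall x, (chart_map @` chart_dom) x ->
    {for x, continuous chart_inv} }.

Record manifold (R : realType) (n : nat) := Manifold {
  points :> topologicalType;
  points_hausdorff : hausdorff_space points;
  points_second_countable : @second_countable points;
  atlas : set (chart R n points);
  atlas_compatible : forall c d, atlas c -> atlas d ->
    smooth_on (c @` (chart_dom c `&` chart_dom d)) (d \o chart_inv c);
  chart_at : points -> chart R n points;
  chart_at_atlas : forall p, atlas (chart_at p);
  chart_at_dom : forall p, chart_dom (chart_at p) p }.

Definition tangent (R : realType) (n : nat) (M : manifold R n) (p : M) :
  lmodType R := 'rV[R]_n.

Section Maps.
Context {R : realType} {m n : nat} {M : manifold R m} {N : manifold R n}.

Definition smooth_map (f : M -> N) : Prop :=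
  continuous f /\
  forall p, smooth_at (chart_at (f p) \o f \o chart_inv (chart_at p))
                      (chart_at p p).

Definition dmap (f : M -> N) (p : M) (v : tangent p) : tangent (f p) :=
  'd (chart_at (f p) \o f \o chart_inv (chart_at p)) (chart_at p p) v.

Definition immersion (f : M -> N) : Prop :=
  smooth_map f /\ forall p, injective (@dmap f p).

Definition vfield_along (f : M -> N) : Type := forall p : M, tangent (f p).

(* Components in the chart c of a vector v at q; meaningful for q in the       *)
(* domain of c.                                                                *)
Definition components (c : chart R n N) (q : N) (v : tangent q) : 'rV[R]_n :=
  'd (c \o chart_inv (chart_at q)) (chart_at q q) v.

Definition smooth_along (f : M -> N) (V : vfield_along f) (p : M) : Prop :=
  smooth_at ((fun q => components (chart_at (f p)) (V q))
               \o chart_inv (chart_at p))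
            (chart_at p p).

End Maps.

Section Functions.
Context {R : realType} {n : nat} {M : manifold R n}.

Definition smooth_fun (h : M -> R) (p : M) : Prop :=
  smooth_at (h \o chart_inv (chart_at p)) (chart_at p p).

(* The derivative v(h) of the function h along v.                              *)
Definition dfun (p : M) (v : tangent p) (h : M -> R) : R :=
  'd (h \o chart_inv (chart_at p)) (chart_at p p) v.

End Functions.

Section Tensors.
Context {R : realType} {n : nat} (M : manifold R n).

Definition vfield : Type := forall p : M, tangent p.

Definition smooth_vf (X : vfield) (p : M) : Prop := smooth_along (f := @idfun M) X p.

Definition one_form : Type := forall p : M, tangent p -> R.

Record is_one_form (w : one_form) : Prop := {
  one_form_linear : forall p (a : R) (u v : tangent p),
    w p (a *: u + v) = a * w p u + w p v;
  one_form_smooth : forall p (X : vfield), smooth_vf X p ->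
    smooth_fun (fun q => w q (X q)) p }.

Definition endo_field : Type := forall p : M, tangent p -> tangent p.

Record is_tensor11 (F : endo_field) : Prop := {
  tensor11_linear : forall p (a : R) (u v : tangent p),
    F p (a *: u + v) = a *: F p u + F p v;
  tensor11_smooth : forall p (X : vfield), smooth_vf X p ->
    smooth_vf (fun q => F q (X q)) p }.

Definition form_field : Type := forall p : M, tangent p -> tangent p -> R.

Record is_metric (g : form_field) : Prop := {
  metric_linear : forall p (a : R) (u v w : tangent p),
    g p (a *: u + v) w = a * g p u w + g p v w;
  metric_sym : forall p (u v : tangent p), g p u v = g p v u;
  metric_pos : forall p (v : tangent p), v != 0 -> 0 < g p v v;
  metric_smooth : forall p (X Y : vfield), smooth_vf X p -> smooth_vf Y p ->
    smooth_fun (fun q => g q (X q) (Y q)) p }.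

End Tensors.

Section Connections.
Context {R : realType} {m n : nat} {M : manifold R m} {N : manifold R n}.

(* Connections on the bundle f^*TN over M. As usual, the value of D_X V at p   *)
(* depends on X only through X_p, and D is also applied to local sections V.   *)
(* An affine connection on M is the case f = id.                               *)
Definition connection_along (f : M -> N) : Type :=
  forall p : M, tangent p -> vfield_along f -> tangent (f p).

Record is_connection_along (f : M -> N) (D : connection_along f) : Prop := {
  conn_linear : forall p (a : R) (u v : tangent p) (V : vfield_along f),
    smooth_along V p -> D p (a *: u + v) V = a *: D p u V + D p v V;
  conn_add : forall p (v : tangent p) (V W : vfield_along f),
    smooth_along V p -> smooth_along W p ->
    D p v (fun q => V q + W q) = D p v V + D p v W;
  conn_leibniz : forall p (v : tangent p) (h : M -> R) (V : vfield_along f),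
    smooth_fun h p -> smooth_along V p ->
    D p v (fun q => h q *: V q) = dfun v h *: V p + h p *: D p v V;
  conn_smooth : forall p (X : vfield M) (V : vfield_along f),
    smooth_vf X p -> smooth_along V p ->
    smooth_along (f := f) (fun q => D q (X q) V) p }.

End Connections.

Section AffineConnections.
Context {R : realType} {n : nat} {M : manifold R n}.

Definition connection : Type :=
  forall p : M, tangent p -> vfield M -> tangent p.

Definition is_connection (nabla : connection) : Prop :=
  is_connection_along (f := @idfun M) nabla.

(* w is the value at p of the Lie bracket [X, Y].                              *)
Definition lie_bracket_at (p : M) (X Y : vfield M) (w : tangent p) : Prop :=
  forall h : M -> R, smooth_fun h p ->
    dfun w h = dfun (X p) (fun q => dfun (Y q) h)
             - dfun (Y p) (fun q => dfun (X q) h).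

Definition torsion_free (nabla : connection) : Prop :=
  forall p (X Y : vfield M), smooth_vf X p -> smooth_vf Y p ->
    @lie_bracket_at p X Y (nabla p (X p) Y - nabla p (Y p) X).

(* (nabla_X g)(Y, Z) at p.                                                     *)
Definition nabla_metric (nabla : connection) (g : form_field M)
    (X Y Z : vfield M) (p : M) : R :=
  dfun (X p) (fun q => g q (Y q) (Z q))
  - g p (nabla p (X p) Y) (Z p) - g p (Y p) (nabla p (X p) Z).

Record statistical_manifold (g : form_field M) (nabla : connection) : Prop := {
  stat_metric : is_metric g;
  stat_connection : is_connection nabla;
  stat_torsion_free : torsion_free nabla;
  stat_symmetric : forall p (X Y Z : vfield M),
    smooth_vf X p -> smooth_vf Y p -> smooth_vf Z p ->
    nabla_metric nabla g X Y Z p = nabla_metric nabla g Y X Z p /\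
    nabla_metric nabla g X Y Z p = nabla_metric nabla g X Z Y p }.

Record dual_connection (g : form_field M) (nabla nablas : connection) :
    Prop := {
  dual_is_connection : is_connection nablas;
  dual_eq : forall p (X Y Z : vfield M),
    smooth_vf X p -> smooth_vf Y p -> smooth_vf Z p ->
    dfun (Z p) (fun q => g q (X q) (Y q))
    = g p (X p) (nablas p (Z p) Y) + g p (nabla p (Z p) X) (Y p) }.

Record locally_product_like (g : form_field M) (nabla : connection)
    (F Fs : endo_field M) : Prop := {
  lpl_statistical : statistical_manifold g nabla;
  lpl_tensor : is_tensor11 F;
  lpl_involutive : forall p (v : tangent p), F p (F p v) = v;
  lpl_parallel : forall p (X Y : vfield M), smooth_vf X p -> smooth_vf Y p ->
    nabla p (X p) (fun q => F q (Y q)) = F p (nabla p (X p) Y);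
  lpl_adjoint_tensor : is_tensor11 Fs;
  lpl_adjoint : forall p (u v : tangent p), g p (F p u) v = g p u (Fs p v) }.

(* (nabla-bar_X A)_N Y at p.                                                   *)
Definition nabla_shape (nabla : connection) (A : endo_field M)
    (kappa : one_form M) (X Y : vfield M) (p : M) : tangent p :=
  nabla p (X p) (fun q => A q (Y q)) - kappa p (X p) *: A p (Y p)
  - A p (nabla p (X p) Y).

(* (nabla-bar^*_X A^* )_N Y at p.                                              *)
Definition nabla_shape_dual (nablas : connection) (As : endo_field M)
    (kappa : one_form M) (X Y : vfield M) (p : M) : tangent p :=
  nablas p (X p) (fun q => As q (Y q)) + kappa p (X p) *: As p (Y p)
  - As p (nablas p (X p) Y).

End AffineConnections.

Section Hypersurfaces.
Context {R : realType} {n : nat} {Mt : manifold R n.+1} {M : manifold R n}.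
Variables (iota : M -> Mt) (gt : form_field Mt).

Definition induced_metric : form_field M :=
  fun p u v => gt (dmap iota u) (dmap iota v).

Record unit_normal (N : vfield_along iota) : Prop := {
  normal_smooth : forall p, smooth_along N p;
  normal_unit : forall p, gt (N p) (N p) = 1;
  normal_orthogonal : forall p (v : tangent p), gt (N p) (dmap iota v) = 0 }.

Definition tangential (F Fs : endo_field Mt) (N : vfield_along iota) : Prop :=
  forall p, (exists v : tangent p, dmap iota v = F (iota p) (N p)) /\
            (exists v : tangent p, dmap iota v = Fs (iota p) (N p)).

(* The meaning of (nablat_v V) for v tangent to M and V a vector field of Mt   *)
(* defined along M only: D is the pull-back of nablat to iota^*TMt, i.e. the   *)
(* unique connection there that agrees with nablat on restrictions to M of     *)
(* (local) vector fields of Mt.                                                *)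
Record pullback_connection (nablat : @connection R n.+1 Mt)
    (D : connection_along iota) : Prop := {
  pullback_is_connection : is_connection_along D;
  pullback_eq : forall p (v : tangent p) (Z : vfield Mt),
    smooth_vf Z (iota p) ->
    D p v (fun q => Z (iota q)) = nablat (iota p) (dmap iota v) Z }.

(* D and Ds are the pull-backs of the ambient connection and of its dual.      *)
Record gauss_weingarten (D Ds : connection_along iota) (N : vfield_along iota)
    (nabla nablas : @connection R n M) (A As : endo_field M)
    (kappa : one_form M) : Prop := {
  gauss : forall p (v : tangent p) (Y : vfield M), smooth_vf Y p ->
    D p v (fun q => dmap iota (Y q))
    = dmap iota (nabla p v Y) + induced_metric (As p v) (Y p) *: N p;
  weingarten : forall p (v : tangent p),
    D p v N = - dmap iota (A p v) + kappa p v *: N p;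
  gauss_dual : forall p (v : tangent p) (Y : vfield M), smooth_vf Y p ->
    Ds p v (fun q => dmap iota (Y q))
    = dmap iota (nablas p v Y) + induced_metric (A p v) (Y p) *: N p;
  weingarten_dual : forall p (v : tangent p),
    Ds p v N = - dmap iota (As p v) - kappa p v *: N p }.

End Hypersurfaces.

(* Main.v *)
(* Write R^D, R^Ds for the curvatures of the pulled-back connections on the
   ambient tangent bundle along M. By Weingarten, the tangential part of
   R^Ds(X, Y) N is -((nabla^*_X A^* ) Y - (nabla^*_Y A^* ) X), and that of
   R^D(X, Y) N is -((nabla_X A) Y - (nabla_Y A) X). Since FN is tangent, hence
   orthogonal to N, duality and parallelism of F give
     g(R^Ds(X, Y) N, FN) = - g(N, R^D(X, Y) FN) = - g(N, F R^D(X, Y) N)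
                         = - g(F^* N, R^D(X, Y) N).
   Two points need care. The bracket [X, Y] is replaced by
   nabla_X Y - nabla_Y X and by nabla^*_X Y - nabla^*_Y X; these agree because
   the difference of the dual connections is a symmetric tensor, by the total
   symmetry of nabla g. And the identities assumed of the ambient connections
   are transported to sections along M by expanding these in the coordinate
   frames of the charts of the ambient manifold. *)

Require Import Defs.
From HB Require Import structures.
From mathcomp Require Import all_boot all_order all_algebra.
From mathcomp Require Import all_classical all_reals all_analysis.
Import Order.TTheory GRing.Theory Num.Theory.
Import numFieldNormedType.Exports.
Local Open Scope classical_set_scope.
Local Open Scope ring_scope.
From mathcomp Require Import ring lra.
Set Implicit Arguments.
Unset Strict Implicit.

(** * Calculus of C^k maps *)

Section DifferentialCalculus.
Context {R : realType} {V W : normedModType R}.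

(** The first-order expansion characterising the differential sees only the germ of [f] at [x], so
    it carries over to [g]; its uniqueness identifies the two differentials. *)
Lemma near_eq_diff_def (f g : V -> W) (x : V) : (\near x, f x = g x) ->
  differentiable f x ->
  differentiable g x /\ 'd g x = 'd f x :> (V -> W).
Proof.
move=> fg /[dup] df /diff_locallyP[cdf /eqaddoP dfx].
have gx : continuous ('d f x) /\ g \o shift x = cst (g x) + 'd f x +o_ 0 id.
  split=> //; apply/eqaddoP => e e0.
  have := dfx _ e0; rewrite -(nbhs_singleton fg).
  move: fg; rewrite (near_shift 0 x) subr0; apply: filterS2 => y /= fgy.
  by rewrite !fctE /= fgy.
have dg := diff_unique gx.1 gx.2.
split; last exact: dg.
have gl (l : V -> W) : l = 'd f x ->
    continuous l /\ g \o shift x = cst (g x) + l +o_ 0 id by move=> ->.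
exact: (iffRL (diff_locallyP x g)) (gl _ dg).
Qed.

Lemma near_eq_differentiable (f g : V -> W) (x : V) : (\near x, f x = g x) ->
  differentiable f x -> differentiable g x.
Proof. by move=> fg /(near_eq_diff_def fg)[]. Qed.

Lemma near_eq_diff (f g : V -> W) (x v : V) : (\near x, f x = g x) ->
  differentiable f x -> 'd g x v = 'd f x v.
Proof. by move=> fg /(near_eq_diff_def fg)[_ ->]. Qed.

(** Registered as an instance below, so that the differentiation rule for bilinear maps yields the
    product rule for [h *: f]. *)
Lemma scale_is_bilinear :
  bilinear_for
    (GRing.Scale.Law.clone _ _ *:%R _) (GRing.Scale.Law.clone _ _ *:%R _)
    (@GRing.scale R W).
Proof.
split=> [u'|u] a x y /=; first by rewrite scalerDl scalerA.
by rewrite scalerDr !scalerA mulrC.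
Qed.

HB.instance Definition _ :=
  bilinear_isBilinear.Build R R W W _ _ (@GRing.scale R W) scale_is_bilinear.

Lemma diff_scale_def (h : V -> R) (f : V -> W) x :
  differentiable h x -> differentiable f x ->
  differentiable (fun y => h y *: f y) x /\
  'd (fun y => h y *: f y) x =
    (fun v => 'd h x v *: f x + h x *: 'd f x v) :> (V -> W).
Proof.
move=> dh df; have dhf := differentiable_pair dh df.
have cs : continuous (fun p : R * W => p.1 *: p.2) by exact: scale_continuous.
have ds (p : R * W) : differentiable (fun p : R * W => p.1 *: p.2) p.
  exact: (@differentiable_bilin _ _ _ _ (@GRing.scale R W)).
have -> : (fun y => h y *: f y) = (fun p => p.1 *: p.2) \o (fun y => (h y, f y)).
  by [].
split; first exact: differentiable_comp.
rewrite diff_comp// (@diff_bilin _ _ _ _ (@GRing.scale R W))// diff_pair//.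
by apply/funext => v /=; rewrite addrC.
Qed.

Lemma differentiable_scale (h : V -> R) (f : V -> W) x :
  differentiable h x -> differentiable f x ->
  differentiable (fun y => h y *: f y) x.
Proof. by move=> dh df; have [] := diff_scale_def dh df. Qed.

Lemma diff_scale (h : V -> R) (f : V -> W) x v :
  differentiable h x -> differentiable f x ->
  'd (fun y => h y *: f y) x v = 'd h x v *: f x + h x *: 'd f x v.
Proof. by move=> dh df; have [_ ->] := diff_scale_def dh df. Qed.

End DifferentialCalculus.

Section CkCalculus.
Context {R : realType} {V W : normedModType R}.
Implicit Types (U : set V) (f g : V -> W) (k : nat).

Lemma CkW k U f : Ck k.+1 U f -> Ck k U f.
Proof.
elim: k f => [|k IH] f [df cf]; last by split=> // v; exact/IH/cf.
by move=> x /df; exact: differentiable_continuous.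
Qed.

Lemma sub_Ck k U U' f : U' `<=` U -> Ck k U f -> Ck k U' f.
Proof.
move=> sU; elim: k f => [|k IH] f; first by move=> cf x /sU; exact: cf.
by move=> [df cf]; split=> [x /sU|v]; [exact: df|exact/IH/cf].
Qed.

(** Openness of [U] makes [f] and [g] agree near each point of [U], so their derivatives agree on
    [U] as well and the induction proceeds. *)
Lemma eq_Ck k U f g : open U -> {in U, f =1 g} -> Ck k U f -> Ck k U g.
Proof.
move=> oU; elim: k f g => [|k IH] f g fg.
  move=> cf x Ux; have fgx : \near x, f x = g x.
    by apply: filterS (open_nbhs_nbhs (conj oU Ux)) => y /mem_set/fg.
  rewrite /prop_for /continuous_at -(nbhs_singleton fgx).
  exact: cvg_trans (near_eq_cvg fgx) (cf x Ux).
have fgx x : U x -> \near x, f x = g x.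
  by move=> Ux; apply: filterS (open_nbhs_nbhs (conj oU Ux)) => y /mem_set/fg.
move=> [df cf]; split=> [x Ux|v].
  exact: near_eq_differentiable (fgx _ Ux) (df _ Ux).
apply: IH (cf v) => x /set_mem Ux.
by rewrite (near_eq_diff v (fgx _ Ux) (df _ Ux)).
Qed.

Lemma Ck_cst k U (a : W) : Ck k U (fun=> a).
Proof.
elim: k a => [|k IH] a; first by move=> x _; exact: cvg_cst.
split=> [x _|v]; first exact: differentiable_cst.
by under eq_fun do rewrite diff_cst; exact: IH.
Qed.

Lemma CkD k U f g : open U ->
  Ck k U f -> Ck k U g -> Ck k U (fun x => f x + g x).
Proof.
move=> oU; elim: k f g => [|k IH] f g cf cg.
  by move=> x Ux; apply: continuousD; [exact: cf|exact: cg].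
case: cf cg => [df cf] [dg cg].
split=> [x Ux|v]; first by apply: differentiableD; [exact: df|exact: dg].
apply: eq_Ck (IH _ _ (cf v) (cg v)) => // x /set_mem Ux.
have /(congr1 (@^~ v)) /= := diffD (df _ Ux) (dg _ Ux).
exact: esym.
Qed.

Lemma Ck_sum k U (I : finType) (f : I -> V -> W) : open U ->
  (forall i, Ck k U (f i)) -> Ck k U (fun x => \sum_i f i x).
Proof.
move=> oU cf; have -> : (fun x => \sum_i f i x) = \sum_i f i.
  by apply/funext => x; rewrite fct_sumE.
by elim/big_ind : _ => [|g h|i _]; [exact: Ck_cst|exact: CkD|exact: cf].
Qed.

End CkCalculus.

Section CkScaleLinear.
Context {R : realType} {V W : normedModType R}.

(** The derivative of a product is a sum of two products, each covered by the induction hypothesis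
    once the undifferentiated factor is weakened by [CkW]. *)
Lemma Ck_scale k (U : set V) (h : V -> R) (f : V -> W) : open U ->
  Ck k U h -> Ck k U f -> Ck k U (fun x => h x *: f x).
Proof.
move=> oU; elim: k h f => [|k IH] h f ch cf.
  by move=> x Ux; apply: cvgZ; [exact: ch|exact: cf].
have [ch' cf'] := (CkW ch, CkW cf).
case: ch cf => [dh ch] [df cf].
split=> [x Ux|v]; first by apply: differentiable_scale; [exact: dh|exact: df].
have := CkD oU (IH _ _ (ch v) cf') (IH _ _ ch' (cf v)).
apply: eq_Ck => // x /set_mem Ux.
by have [dhx dfx] := (dh _ Ux, df _ Ux); rewrite diff_scale.
Qed.

Lemma Ck_linear k (U : set V) (f : V -> W) {W' : normedModType R}
    (l : {linear W -> W'}) : open U -> continuous l ->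
  Ck k U f -> Ck k U (l \o f).
Proof.
move=> oU cl; elim: k f => [|k IH] f.
  by move=> cf x Ux; apply: continuous_comp; [exact: cf|exact: cl].
have dl y : differentiable l y by exact: linear_differentiable.
move=> [df cf]; split=> [x Ux|v].
  by apply: differentiable_comp => //; exact: df.
apply: eq_Ck (IH _ (cf v)) => // x /set_mem Ux /=.
by rewrite (diff_comp (df _ Ux) (dl _))/= (diff_lin _ cl).
Qed.

End CkScaleLinear.

Section CkComposition.
Context {R : realType} {V W : normedModType R}.

Lemma Ck_coord k m (U : set V) (f : V -> 'rV[R]_m) i : open U ->
  Ck k U f -> Ck k U (fun x => f x 0 i).
Proof.
move=> oU cf.
have lin : linear (fun M : 'rV[R]_m => M 0 i : R) by move=> a u v; rewrite !mxE.
pose lM := GRing.isLinear.Build _ _ _ _ _ lin.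
pose l : {linear 'rV[R]_m -> R} := HB.pack (fun M : 'rV[R]_m => M 0 i : R) lM.
have cl : continuous l by exact: coord_continuous.
exact: Ck_linear oU cl cf.
Qed.

Lemma linear_rV_sum m (l : {linear 'rV[R]_m -> W}) w :
  l w = \sum_i w 0 i *: l (delta_mx 0 i).
Proof.
rewrite {1}(row_sum_delta w) linear_sum.
by apply: eq_bigr => i _; rewrite linearZ.
Qed.

(** [Ck] differentiates in fixed directions, whereas the chain rule differentiates [g] in the
    direction ['d f x v], which varies with [x]. Expanding this direction in the standard basis
    leaves derivatives of [g] in fixed directions with C^k coefficients; hence the middle space is a
    space of rows. *)
Lemma Ck_comp k m (U : set V) (U' : set 'rV[R]_m) (f : V -> 'rV[R]_m)
    (g : 'rV[R]_m -> W) : open U -> f @` U `<=` U' ->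
  Ck k U f -> Ck k U' g -> Ck k U (g \o f).
Proof.
move=> oU sU; elim: k g => [|k IH] g cf cg.
  move=> x Ux; apply: continuous_comp; first exact: cf.
  by apply: cg; apply: sU; exists x.
have cf' := CkW cf; case: cf cg => [df cf] [dg cg].
have {}dg x : U x -> differentiable g (f x).
  by move=> Ux; apply: dg; apply: sU; exists x.
split=> [x Ux|v]; first by apply: differentiable_comp; [exact: df|exact: dg].
have cgf i := IH _ cf' (cg (delta_mx 0 i)).
have := @Ck_sum _ _ _ k U _ _ oU
  (fun i => Ck_scale oU (Ck_coord i oU (cf v)) (cgf i)).
apply: eq_Ck => // x /set_mem Ux.
by rewrite (diff_comp (df _ Ux) (dg _ Ux)) /= linear_rV_sum.
Qed.

End CkComposition.

Section SmoothAt.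
Context {R : realType} {V W : normedModType R}.
Implicit Types (f g : V -> W) (x : V).

Lemma smooth_on_at (U : set V) f x : open U -> U x -> smooth_on U f ->
  smooth_at f x.
Proof. by move=> oU Ux sf; exists U. Qed.

Lemma smooth_at_differentiable f x : smooth_at f x -> differentiable f x.
Proof. by move=> [U [oU Ux] sf]; have [df _] := sf 1%N; exact: df. Qed.

Lemma smooth_at_diff f x v : smooth_at f x -> smooth_at (fun y => 'd f y v) x.
Proof. by move=> [U oU sf]; exists U => // k; have [_] := sf k.+1; exact. Qed.

Lemma near_eq_smooth_at f g x : (\near x, f x = g x) ->
  smooth_at f x -> smooth_at g x.
Proof.
move=> fg [U oU sf]; have : nbhs x [set y | f y = g y] := fg.
rewrite nbhsE => -[U' oU' {}fg].
exists (U `&` U'); first exact: open_nbhsI.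
have [oUU' _] := open_nbhsI oU oU'.
move=> k; apply: (@eq_Ck _ _ _ _ _ f) => //.
  by move=> y /set_mem[_ /fg].
by apply: sub_Ck (sf k) => y [].
Qed.

Lemma smooth_at_cst (a : W) x : smooth_at (fun=> a) x.
Proof.
exists setT; last by move=> k; exact: Ck_cst.
by split => //; exact: openT.
Qed.

Lemma smooth_atD f g x :
  smooth_at f x -> smooth_at g x -> smooth_at (fun y => f y + g y) x.
Proof.
move=> [U oU sf] [U' oU' sg]; exists (U `&` U'); first exact: open_nbhsI.
have [oUU' _] := open_nbhsI oU oU'.
move=> k; apply: CkD => //.
  by apply: sub_Ck (sf k) => y [].
by apply: sub_Ck (sg k) => y [].
Qed.

Lemma smooth_at_scale (h : V -> R) f x :
  smooth_at h x -> smooth_at f x -> smooth_at (fun y => h y *: f y) x.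
Proof.
move=> [U oU sf] [U' oU' sg]; exists (U `&` U'); first exact: open_nbhsI.
have [oUU' _] := open_nbhsI oU oU'.
move=> k; apply: Ck_scale => //.
  by apply: sub_Ck (sf k) => y [].
by apply: sub_Ck (sg k) => y [].
Qed.

Lemma smooth_at_coord m (f : V -> 'rV[R]_m) x i :
  smooth_at f x -> smooth_at (fun y => f y 0 i) x.
Proof. by move=> [U oU sf]; exists U => // k; apply: Ck_coord; case: oU. Qed.

Lemma smooth_at_comp m (f : V -> 'rV[R]_m) (g : 'rV[R]_m -> W) x :
  smooth_at f x -> smooth_at g (f x) -> smooth_at (g \o f) x.
Proof.
move=> [U [oU Ux] sf] [U' oU' sg].
(* Continuity of [f], the order 0 case of its smoothness, gives a neighbourhood that is mapped into
   [U']. *)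
have [U'' [oU'' U''x] U''U'] :
    exists2 U'' : set V, open_nbhs x U'' & f @` (U `&` U'') `<=` U'.
  have : nbhs x [set y | U' (f y)] by exact: (sf 0%N x Ux) (open_nbhs_nbhs oU').
  rewrite nbhsE => -[U'' oU'' sU'']; exists U'' => // _ [y [_ U''y] <-].
  exact: sU''.
exists (U `&` U''); first by split; [exact: openI|].
move=> k; apply: Ck_comp U''U' _ (sg k); first exact: openI.
by apply: sub_Ck (sf k) => y [].
Qed.

End SmoothAt.

(** * Charts *)

Section Charts.
Context {R : realType} {n : nat} {M : manifold R n}.
Implicit Types (c d : chart R n M) (p q : M).

Lemma near_chart_inv c p (P : set M) : chart_dom c p -> (\near p, P p) ->
  \forall y \near c p, P (chart_inv c y).
Proof.
move=> cp nP.
have cv : {for c p, continuous (chart_inv c)}.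
  by apply: chart_inv_cont; exists p.
by apply: cv; rewrite /= chart_mapK.
Qed.

Lemma near_chart_dom c p : chart_dom c p -> \near p, chart_dom c p.
Proof. by move=> cp; apply: open_nbhs_nbhs; split=> //; exact: chart_dom_open. Qed.

Lemma near_chart_invK c p : chart_dom c p ->
  \forall y \near c p, c (chart_inv c y) = y.
Proof.
move=> cp; have : nbhs (c p) (c @` chart_dom c).
  by apply: open_nbhs_nbhs; split; [exact: chart_img_open|exists p].
by apply: filterS => _ [q cq <-]; rewrite chart_mapK.
Qed.

Lemma open_chart_img c (A : set M) : open A -> open (c @` (chart_dom c `&` A)).
Proof.
move=> oA; rewrite openE => _ [p [cp Ap] <-].
have nA : \near p, (chart_dom c `&` A) p.
  by apply: open_nbhs_nbhs; split=> //; apply: openI => //; exact: chart_dom_open.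
apply: filterS2 (near_chart_invK cp) (near_chart_inv cp nA) => y cy Ay.
by exists (chart_inv c y).
Qed.

Lemma smooth_at_transition c d p : atlas c -> atlas d ->
  chart_dom c p -> chart_dom d p -> smooth_at (d \o chart_inv c) (c p).
Proof.
move=> ac ad cp dp; apply: smooth_on_at (atlas_compatible ac ad).
  exact/open_chart_img/chart_dom_open.
by exists p.
Qed.

Section ChartChange.
Context {W : normedModType R}.
Variables (c d : chart R n M) (q : M).
Hypotheses (ac : atlas c) (ad : atlas d) (cq : chart_dom c q) (dq : chart_dom d q).
Implicit Types G : M -> W.

Lemma near_chart_change G :
  \forall y \near d q, ((G \o chart_inv c) \o (c \o chart_inv d)) y
                       = (G \o chart_inv d) y.
Proof.
apply: filterS (near_chart_inv dq (near_chart_dom cq)) => y cy /=.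
by rewrite chart_mapK.
Qed.

(** Transition maps are smooth, so smoothness at [q] may be tested in any chart of the atlas around
    [q]. *)
Lemma smooth_at_chart_change G : smooth_at (G \o chart_inv c) (c q) ->
  smooth_at (G \o chart_inv d) (d q).
Proof.
move=> sG; apply: near_eq_smooth_at (near_chart_change G) _.
apply: smooth_at_comp; first exact: smooth_at_transition.
by rewrite /= chart_mapK.
Qed.

Lemma diff_chart_change G v : differentiable (G \o chart_inv c) (c q) ->
  'd (G \o chart_inv d) (d q) v =
  'd (G \o chart_inv c) (c q) ('d (c \o chart_inv d) (d q) v).
Proof.
move=> dG; have sT := smooth_at_transition ad ac dq cq.
have dT := smooth_at_differentiable sT.
have cdq : (c \o chart_inv d) (d q) = c q by rewrite /= chart_mapK.
have dG' : differentiable (G \o chart_inv c) ((c \o chart_inv d) (d q)).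
  by rewrite cdq.
have dGT := differentiable_comp dT dG'.
transitivity ('d ((G \o chart_inv c) \o (c \o chart_inv d)) (d q) v).
  exact: near_eq_diff v (near_chart_change G) dGT.
have /(congr1 (@^~ v)) /= := diff_comp dT dG'.
by rewrite (chart_mapK dq).
Qed.

End ChartChange.

(** [chart_inv c] is a right inverse of [c] only over the image of the domain; this contains a
    neighbourhood of [c q], which suffices for the differential. *)
Lemma diff_transition_refl c q v : chart_dom c q ->
  'd (c \o chart_inv c) (c q) v = v.
Proof.
move=> cq; have cK : \forall y \near c q, id y = (c \o chart_inv c) y.
  by apply: filterS (near_chart_invK cq) => y; exact: esym.
have [did dv] := is_diff_id (c q).
exact: etrans (near_eq_diff v cK did) (congr1 (@^~ v) dv).
Qed.

Lemma diff_transitionK c d q v : atlas c -> atlas d ->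
  chart_dom c q -> chart_dom d q ->
  'd (d \o chart_inv c) (c q) ('d (c \o chart_inv d) (d q) v) = v.
Proof.
move=> ac ad cq dq; rewrite -diff_chart_change//; first exact: diff_transition_refl.
exact/smooth_at_differentiable/smooth_at_transition.
Qed.

(** The coordinate field of [c] with constant components [w]; the differential of the transition map
    rewrites these in the preferred chart at [q], as [tangent q] demands. It is meaningful on the
    domain of [c]. *)
Definition frame c (w : 'rV[R]_n) : vfield M :=
  fun q => 'd (chart_at q \o chart_inv c) (c q) w.

Lemma components_frame c q w : atlas c -> chart_dom c q ->
  components c (frame c w q) = w.
Proof.
move=> ac cq; apply: diff_transitionK => //.
  exact: chart_at_atlas.
exact: chart_at_dom.
Qed.

Lemma frame_components c q (v : tangent q) : atlas c -> chart_dom c q ->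
  frame c (components c v) q = v.
Proof.
move=> ac cq; apply: diff_transitionK => //.
  exact: chart_at_atlas.
exact: chart_at_dom.
Qed.

End Charts.

(** * Functions on a manifold with values in a normed space *)

Section SmoothVectorValued.
Context {R : realType} {n : nat} {M : manifold R n} {W : normedModType R}.
Implicit Types (G : M -> W) (p q : M).

(** For real values this is [smooth_fun], and for the components of a section it is [smooth_along],
    both by conversion; one calculus thus serves functions and sections. *)
Definition msmooth G p := smooth_at (G \o chart_inv (chart_at p)) (chart_at p p).

Definition mdiff G p (v : tangent p) : W :=
  'd (G \o chart_inv (chart_at p)) (chart_at p p) v.

Lemma near_eq_chart_at G G' p : (\near p, G p = G' p) ->
  \forall y \near chart_at p p, (G \o chart_inv (chart_at p)) y
                                = (G' \o chart_inv (chart_at p)) y.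
Proof. exact/near_chart_inv/chart_at_dom. Qed.

Lemma near_eq_msmooth G G' p : (\near p, G p = G' p) ->
  msmooth G p -> msmooth G' p.
Proof. by move/near_eq_chart_at; exact: near_eq_smooth_at. Qed.

Lemma near_eq_mdiff G G' p v : (\near p, G p = G' p) ->
  msmooth G p -> mdiff (p := p) G' v = mdiff G v.
Proof.
move/near_eq_chart_at => GG' /smooth_at_differentiable dG.
exact: near_eq_diff v GG' dG.
Qed.

Lemma mdiff_chart c G q (v : tangent q) : atlas c -> chart_dom c q ->
  smooth_at (G \o chart_inv c) (c q) ->
  mdiff G v = 'd (G \o chart_inv c) (c q) (components c v).
Proof.
move=> ac cq /smooth_at_differentiable dG; apply: diff_chart_change => //.
  exact: chart_at_atlas.
exact: chart_at_dom.
Qed.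

Lemma msmooth_chart c G q : atlas c -> chart_dom c q ->
  msmooth G q -> smooth_at (G \o chart_inv c) (c q).
Proof.
move=> ac cq; apply: smooth_at_chart_change => //.
  exact: chart_at_atlas.
exact: chart_at_dom.
Qed.

End SmoothVectorValued.

Section VectorValuedCalculus.
Context {R : realType} {n : nat} {M : manifold R n} {W : normedModType R}.
Implicit Types (G : M -> W) (h : M -> R) (p : M).

Lemma msmooth_cst (a : W) p : msmooth (fun _ : M => a) p.
Proof. exact: smooth_at_cst. Qed.

Lemma msmoothD G G' p :
  msmooth G p -> msmooth G' p -> msmooth (fun q => G q + G' q) p.
Proof. exact: smooth_atD. Qed.

Lemma msmooth_scale h G p :
  msmooth h p -> msmooth G p -> msmooth (fun q => h q *: G q) p.
Proof. exact: smooth_at_scale. Qed.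

Lemma mdiff_cst (a : W) p v : mdiff (p := p) (fun _ : M => a) v = 0.
Proof.
have /(congr1 (@^~ v)) := @diff_cst _ 'rV[R]_n W a (chart_at p p).
exact.
Qed.

Lemma mdiffD G G' p v : msmooth G p -> msmooth G' p ->
  mdiff (p := p) (fun q => G q + G' q) v = mdiff G v + mdiff G' v.
Proof.
move=> /smooth_at_differentiable dG /smooth_at_differentiable dG'.
have /(congr1 (@^~ v)) := diffD dG dG'.
exact.
Qed.

Lemma mdiff_scale h G p v : msmooth h p -> msmooth G p ->
  mdiff (p := p) (fun q => h q *: G q) v = mdiff h v *: G p + h p *: mdiff G v.
Proof.
move=> /smooth_at_differentiable dh /smooth_at_differentiable dG.
have := diff_scale v dh dG.
by rewrite /= (chart_mapK (chart_at_dom p)).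
Qed.

End VectorValuedCalculus.

Lemma msmooth_coord (R : realType) (n m : nat) (M : manifold R n)
    (G : M -> 'rV[R]_m) p i :
  msmooth G p -> msmooth (fun q => G q 0 i) p.
Proof. exact: smooth_at_coord. Qed.

Section SmoothMaps.
Context {R : realType} {m n : nat} {M : manifold R m} {N : manifold R n}.
Context {W : normedModType R}.
Variable f : M -> N.
Hypothesis sf : smooth_map f.
Implicit Types (G : N -> W) (p : M).

Lemma near_smooth_map (c : chart R n N) p : chart_dom c (f p) ->
  \near p, chart_dom c (f p).
Proof. by move=> /near_chart_dom; exact: sf.1. Qed.

Lemma near_chart_comp G p : \forall y \near chart_at p p,
  ((G \o chart_inv (chart_at (f p))) \o
   (chart_at (f p) \o f \o chart_inv (chart_at p))) y
  = ((G \o f) \o chart_inv (chart_at p)) y.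
Proof.
have := near_chart_inv (chart_at_dom p) (near_smooth_map (chart_at_dom (f p))).
by apply: filterS => y /= /chart_mapK ->.
Qed.

Lemma chart_comp_at p :
  (chart_at (f p) \o f \o chart_inv (chart_at p)) (chart_at p p)
  = chart_at (f p) (f p).
Proof. by rewrite /= (chart_mapK (chart_at_dom p)). Qed.

Lemma msmooth_comp G p : msmooth G (f p) -> msmooth (G \o f) p.
Proof.
move=> sG; apply: near_eq_smooth_at (near_chart_comp G p) _.
by apply: smooth_at_comp; [exact: sf.2|rewrite chart_comp_at].
Qed.

Lemma mdiff_comp G p (v : tangent p) : msmooth G (f p) ->
  mdiff (G \o f) v = mdiff G (dmap f v).
Proof.
move=> /smooth_at_differentiable dG.
have df := smooth_at_differentiable (sf.2 p).
have dG' : differentiable (G \o chart_inv (chart_at (f p)))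
    ((chart_at (f p) \o f \o chart_inv (chart_at p)) (chart_at p p)).
  by rewrite chart_comp_at.
apply: etrans (near_eq_diff v (near_chart_comp G p) (differentiable_comp df dG')) _.
have /(congr1 (@^~ v)) /= := diff_comp df dG'.
by rewrite (chart_mapK (chart_at_dom p)).
Qed.

End SmoothMaps.

(** * Sections along a map *)

Section SectionsAlong.
Context {R : realType} {m n : nat} {M : manifold R m} {N : manifold R n}.
Variable f : M -> N.
Implicit Types (V : vfield_along f) (h : M -> R) (p : M).

Lemma near_eq_smooth_along V V' p : (\near p, V p = V' p) ->
  smooth_along V p -> smooth_along V' p.
Proof.
move=> VV'; apply: near_eq_msmooth.
by apply: filterS VV' => q ->.
Qed.

Lemma smooth_alongD V V' p : smooth_along V p -> smooth_along V' p ->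
  smooth_along (f := f) (fun q => V q + V' q) p.
Proof.
move=> sV sV'; apply: near_eq_msmooth (msmoothD sV sV').
by apply: filterE => q; rewrite /components linearD.
Qed.

Lemma smooth_along_scale h V p : smooth_fun h p -> smooth_along V p ->
  smooth_along (f := f) (fun q => h q *: V q) p.
Proof.
move=> sh sV; apply: near_eq_msmooth (msmooth_scale sh sV).
by apply: filterE => q; rewrite /components linearZ.
Qed.

(** In the chart at [f p] the components are the constant [w] as long as [f q] stays in its domain,
    hence for [q] near [p]. *)
Lemma smooth_along_frame w p : continuous f ->
  smooth_along (f := f) (fun q => frame (chart_at (f p)) w (f q)) p.
Proof.
move=> cf; apply: near_eq_msmooth (msmooth_cst w p).
have cN : \forall q \near p, chart_dom (chart_at (f p)) (f q).
  exact/cf/near_chart_dom/chart_at_dom.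
apply: filterS cN => q cq; rewrite components_frame//; exact: chart_at_atlas.
Qed.

Lemma frameD (c : chart R n N) w w' q :
  frame c (w + w') q = frame c w q + frame c w' q.
Proof. by rewrite /frame linearD. Qed.

Lemma frameZ (c : chart R n N) a w q : frame c (a *: w) q = a *: frame c w q.
Proof. by rewrite /frame linearZ. Qed.

(** Near [p], a section smooth at [p] is a finite combination, with coefficients smooth at [p], of
    coordinate frame fields of [N] restricted along [f]. A property of germs that is stable under
    sums and products with functions thus need only be checked on these restrictions, where
    assumptions about fields of [N] apply. *)
Lemma section_ind p (P : vfield_along f -> Prop) : continuous f ->
  (forall V V', smooth_along V p -> (\near p, V p = V' p) -> P V -> P V') ->
  (forall V V', smooth_along V p -> smooth_along V' p ->
     P V -> P V' -> P (fun q => V q + V' q)) ->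
  (forall h V, smooth_fun h p -> smooth_along V p ->
     P V -> P (fun q => h q *: V q)) ->
  (forall w, P (fun q => frame (chart_at (f p)) w (f q))) ->
  forall V, smooth_along V p -> P V.
Proof.
move=> cf Pnear PD PZ Pframe V sV; set c := chart_at (f p) in Pframe.
pose h i q : R := components c (V q) 0 i.
pose E i : vfield_along f := fun q => frame c (delta_mx 0 i) (f q).
have sE i : smooth_along (E i) p by exact: smooth_along_frame.
have sh i : smooth_fun (h i) p by exact: msmooth_coord.
pose S (s : seq 'I_n) : vfield_along f := fun q => \sum_(i <- s) h i q *: E i q.
have SP s : smooth_along (S s) p /\ P (S s).
  elim: s => [|i s [sS PS]].
    (* The empty sum is the frame field with components 0, so the zero section is no separate
       case. *)
    have -> : S [::] = fun q => frame c 0 (f q).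
      by apply/funext => q; rewrite /S big_nil /frame linear0.
    split; last exact: Pframe.
    exact: smooth_along_frame.
  have -> : S (i :: s) = fun q => h i q *: E i q + S s q.
    by apply/funext => q; rewrite /S big_cons.
  have shE := smooth_along_scale (sh i) (sE i).
  split; first exact: smooth_alongD.
  exact: PD _ _ shE sS (PZ _ _ (sh i) (sE i) (Pframe _)) PS.
have [sS PS] := SP (index_enum 'I_n).
apply: Pnear sS _ PS.
have cN : \near p, chart_dom c (f p) by exact/cf/near_chart_dom/chart_at_dom.
apply: filterS cN => q cq.
rewrite /S -[RHS](@frame_components _ _ _ c)//; last exact: chart_at_atlas.
rewrite [in RHS](row_sum_delta (components c (V q))) /frame linear_sum.
by apply: eq_bigr => i _; rewrite linearZ.
Qed.

Section Connection.
Variable D : connection_along f.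
Hypothesis hD : is_connection_along D.

(* The Leibniz rule for the indicator function of the complement of a
   neighbourhood of p, which is smooth at p, makes D_v local at p. *)
Lemma near_eq_conn p v V V' : smooth_along V p -> (\near p, V p = V' p) ->
  D (p := p) v V' = D v V.
Proof.
move=> sV VV'; have sV' := near_eq_smooth_along VV' sV.
pose Z : vfield_along f := fun q => V' q + (-1) *: V q.
have s1 : smooth_fun (fun _ : M => -1 : R) p by exact: msmooth_cst.
have sNV := smooth_along_scale s1 sV.
have sZ : smooth_along Z p by exact: smooth_alongD.
pose h q : R := if V q == V' q then 0 else 1.
have h0 : \near p, 0 = h p by apply: filterS VV' => q qV; rewrite /h qV eqxx.
have sh : smooth_fun h p by exact: near_eq_msmooth h0 (msmooth_cst _ _).
have hZ : (fun q => h q *: Z q) = Z.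
  apply/funext => q; rewrite /h; case: eqP => [e|_]; last exact: scale1r.
  by rewrite /Z e scaleN1r subrr scaler0.
have := conn_leibniz hD v sh sZ; rewrite hZ.
have -> : dfun v h = 0.
  exact: etrans (near_eq_mdiff v h0 (msmooth_cst _ _)) (mdiff_cst _ _).
rewrite -(nbhs_singleton h0) !scale0r addr0 (conn_add hD v sV' sNV).
rewrite (conn_leibniz hD v s1 sV).
rewrite (_ : dfun v _ = 0); last exact: mdiff_cst.
by rewrite scale0r add0r scaleN1r => /eqP; rewrite subr_eq0 => /eqP.
Qed.

End Connection.
End SectionsAlong.

(** * Metrics and tensor fields *)

Section Metric.
Context {R : realType} {n : nat} {M : manifold R n}.
Variable g : form_field M.
Hypothesis hg : is_metric g.
Implicit Types (p : M) (a : R).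

Lemma metricDl p (u v w : tangent p) : g (u + v) w = g u w + g v w.
Proof. by rewrite -[u in LHS]scale1r (metric_linear hg) mul1r. Qed.

Lemma metric0l p (w : tangent p) : g 0 w = 0.
Proof. by apply: (addrI (g 0 w)); rewrite -metricDl !addr0. Qed.

Lemma metricZl p a (u w : tangent p) : g (a *: u) w = a * g u w.
Proof. by rewrite -[a *: u]addr0 (metric_linear hg) metric0l addr0. Qed.

Lemma metricDr p (u v w : tangent p) : g w (u + v) = g w u + g w v.
Proof. by rewrite !(Defs.metric_sym hg w) metricDl. Qed.

Lemma metricZr p a (u w : tangent p) : g w (a *: u) = a * g w u.
Proof. by rewrite !(Defs.metric_sym hg w) metricZl. Qed.

Lemma metricNl p (u w : tangent p) : g (- u) w = - g u w.
Proof. by rewrite -scaleN1r metricZl mulN1r. Qed.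

Lemma metricNr p (u w : tangent p) : g w (- u) = - g w u.
Proof. by rewrite -scaleN1r metricZr mulN1r. Qed.

Lemma metric_nondegenerate p (u v : tangent p) :
  (forall w, g w u = g w v) -> u = v.
Proof.
move=> uv; apply/eqP; rewrite -subr_eq0; apply/negPn/negP => /(metric_pos hg).
by rewrite metricDr metricNr uv subrr ltxx.
Qed.

End Metric.

Section DmapLinear.
Context {R : realType} {m n : nat} {M : manifold R m} {N : manifold R n}.
Variables (f : M -> N).

Lemma dmapD p (u v : tangent p) : dmap f (u + v) = dmap f u + dmap f v.
Proof. by rewrite /dmap linearD. Qed.

Lemma dmapZ p a (u : tangent p) : dmap f (a *: u) = a *: dmap f u.
Proof. by rewrite /dmap linearZ. Qed.

Lemma dmapN p (u : tangent p) : dmap f (- u) = - dmap f u.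
Proof. by rewrite /dmap linearN. Qed.

End DmapLinear.

Section TensorLinear.
Context {R : realType} {n : nat} {M : manifold R n} {F : endo_field M}.
Hypothesis hF : is_tensor11 F.

Lemma tensor11D p (u v : tangent p) : F (u + v) = F u + F v.
Proof. by rewrite -[u in LHS]scale1r (tensor11_linear hF) scale1r. Qed.

Lemma tensor110 (p : M) : F (0 : tangent p) = 0.
Proof. by apply: (addrI (F 0)); rewrite -tensor11D !addr0. Qed.

Lemma tensor11Z p a (u : tangent p) : F (a *: u) = a *: F u.
Proof. by rewrite -[a *: u]addr0 (tensor11_linear hF) tensor110 addr0. Qed.

End TensorLinear.

Lemma frame_chart_at (R : realType) (n : nat) (M : manifold R n) (p : M)
  (w : tangent p) : frame (chart_at p) w p = w.
Proof. exact/diff_transition_refl/chart_at_dom. Qed.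

Lemma smooth_vf_frame (R : realType) (n : nat) (M : manifold R n) (p : M) w :
  smooth_vf (frame (chart_at p) w) p.
Proof. by apply: (smooth_along_frame (f := idfun)) => q; exact: cvg_id. Qed.

Section SmoothnessAlong.
Context {R : realType} {m n : nat} {M : manifold R m} {N : manifold R n}.
Variable f : M -> N.
Hypothesis sf : smooth_map f.

Lemma smooth_along_comp (Z : vfield N) p : smooth_vf Z (f p) ->
  smooth_along (f := f) (fun q => Z (f q)) p.
Proof. exact: (msmooth_comp sf). Qed.

(** [is_tensor11] speaks of fields of [N], but [V] exists along [f] only; [section_ind] reduces the
    claim to restrictions of frame fields. *)
Lemma smooth_along_tensor (F : endo_field N) (V : vfield_along f) p :
  is_tensor11 F -> smooth_along V p ->
  smooth_along (f := f) (fun q => F (f q) (V q)) p.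
Proof.
move=> hF.
pose P (V : vfield_along f) := smooth_along (f := f) (fun q => F (f q) (V q)) p.
apply: (section_ind (P := P)) sf.1 _ _ _ _ V.
- move=> V V' _ VV'; apply: near_eq_smooth_along.
  by apply: filterS VV' => q ->.
- move=> V V' _ _ sV sV'; rewrite /P; under eq_fun do rewrite (tensor11D hF).
  exact: smooth_alongD.
- move=> h V sh _ sV; rewrite /P; under eq_fun do rewrite (tensor11Z hF).
  exact: smooth_along_scale.
- move=> w; pose Z := fun q => F q (frame (chart_at (f p)) w q).
  apply: (smooth_along_comp (Z := Z)); apply: tensor11_smooth => //.
  exact: smooth_vf_frame.
Qed.

(** Since [dmap] is linear on fibres, [section_ind] on [M] leaves a frame field. The components of
    its image are the derivative of the chart expression of [f] in a constant direction, which is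
    smooth. *)
Lemma smooth_along_dmap (Y : vfield M) p : smooth_vf Y p ->
  smooth_along (f := f) (fun q => dmap f (Y q)) p.
Proof.
pose P (Y : vfield_along (@idfun M)) :=
  smooth_along (f := f) (fun q => dmap f (Y q)) p.
apply: (section_ind (P := P)) _ _ _ _ _ Y.
- by move=> q; exact: cvg_id.
- move=> V V' _ VV'; apply: near_eq_smooth_along.
  by apply: filterS VV' => q ->.
- move=> V V' _ _ sV sV'; rewrite /P; under eq_fun do rewrite dmapD.
  exact: smooth_alongD.
- move=> h V sh _ sV; rewrite /P; under eq_fun do rewrite dmapZ.
  exact: smooth_along_scale.
- move=> w; set c := chart_at p; set c' := chart_at (f p).
  have := smooth_at_diff w (sf.2 p); apply: near_eq_smooth_at.
  have cp : chart_dom c p := chart_at_dom p.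
  have ac : atlas c := chart_at_atlas p.
  have ac' : atlas c' := chart_at_atlas (f p).
  have c'fp := near_smooth_map sf (chart_at_dom (f p)).
  apply: filterS3 (near_chart_invK cp) (near_chart_inv cp c'fp)
    (near_chart_inv cp (near_chart_dom cp)) => y yK c'y cy.
  set q := chart_inv c y in c'y cy *.
  have sc' : msmooth c' (f q).
    by apply: smooth_at_transition => //;
      [exact: chart_at_atlas|exact: chart_at_dom].
  have sc'f := msmooth_comp sf sc'.
  have sc := msmooth_chart ac cy sc'f.
  (* The derivative of [c' \o f] along the frame vector is computed in the chart [c] ([e1]) and by
     the chain rule through [f q] ([e2]). *)
  have e1 : mdiff (c' \o f) (frame c w q) = 'd ((c' \o f) \o chart_inv c) (c q) w.
    apply: etrans (mdiff_chart _ ac cy sc) _.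
    by rewrite (components_frame _ ac cy).
  have qK : c q = y := yK.
  rewrite qK in e1.
  have e2 := mdiff_comp sf (frame c w q) sc'.
  apply: etrans (etrans (esym e1) e2) _.
  by rewrite /mdiff /components /comp.
Qed.

End SmoothnessAlong.

(** * Pulled-back connections *)

Section ConnectionLinear.
Context {R : realType} {m n : nat} {M : manifold R m} {N : manifold R n}.
Context {f : M -> N} {D : connection_along f}.
Hypothesis hD : is_connection_along D.
Implicit Types (V : vfield_along f).

Lemma conn0l p V : smooth_along V p -> D (0 : tangent p) V = 0.
Proof.
move=> sV; have := conn_linear hD 1 0 0 sV.
by rewrite !scale1r addr0 -[LHS]addr0 => /addrI.
Qed.

Lemma connDl p (u v : tangent p) V : smooth_along V p ->
  D (u + v) V = D u V + D v V.
Proof. by move=> sV; rewrite -[u in LHS]scale1r (conn_linear hD)// scale1r. Qed.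

Lemma connNl p (u : tangent p) V : smooth_along V p -> D (- u) V = - D u V.
Proof.
move=> sV; rewrite -[- u]addr0 -scaleN1r (conn_linear hD)// conn0l//.
by rewrite addr0 scaleN1r.
Qed.

Lemma connZr p (v : tangent p) (a : R) V : smooth_along V p ->
  D v (fun q => a *: V q) = a *: D v V.
Proof.
have sa : smooth_fun (fun _ : M => a) p by exact: msmooth_cst.
move=> sV; rewrite (conn_leibniz hD v sa sV).
by rewrite (_ : dfun v _ = 0) ?scale0r ?add0r//; exact: mdiff_cst.
Qed.

End ConnectionLinear.

(** * The difference of dual connections *)

Section AmbientDifference.
Context {R : realType} {n : nat} {M : manifold R n} {g : form_field M}.
Context {nabla nablas : @connection R n M}.
Hypotheses (hM : statistical_manifold g nabla)
  (hdual : dual_connection g nabla nablas).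

(** Duality expresses the covariant derivative of the metric by the difference of the connections,
    so its total symmetry becomes a symmetry of that difference. *)
Lemma nabla_metric_dual p (X Y Z : vfield M) :
  smooth_vf X p -> smooth_vf Y p -> smooth_vf Z p ->
  nabla_metric nabla g X Y Z p
  = g (Y p) (nablas (X p) Z - nabla (X p) Z).
Proof.
move=> sX sY sZ; rewrite /nabla_metric (dual_eq hdual sY sZ sX).
rewrite (metricDr (stat_metric hM)) (metricNr (stat_metric hM)); ring.
Qed.

(** Write C for the covariant derivative of the metric and W for a frame field extending [w]. Total
    symmetry gives C(X,W,Y) = C(X,Y,W) = C(Y,X,W) = C(Y,W,X). *)
Lemma connection_difference_sym p (X Y : vfield M) :
  smooth_vf X p -> smooth_vf Y p ->
  nablas (X p) Y - nabla (X p) Y = nablas (Y p) X - nabla (Y p) X.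
Proof.
move=> sX sY; apply: (metric_nondegenerate (stat_metric hM)) => w.
have sW := smooth_vf_frame p w.
rewrite -[w](frame_chart_at (p := p)) -!nabla_metric_dual//.
rewrite (stat_symmetric hM sX sW sY).2 (stat_symmetric hM sX sY sW).1.
by rewrite -(stat_symmetric hM sY sW sX).2.
Qed.

(** Extending [w] by a coordinate field turns the difference of the connections into a function of
    vectors at [p], which can then be evaluated on sections given along [iota] only. *)
Definition difference_tensor p (u w : tangent p) : tangent p :=
  nablas u (frame (chart_at p) w) - nabla u (frame (chart_at p) w).

Lemma difference_tensor_sym p (u w : tangent p) :
  difference_tensor u w = difference_tensor w u.
Proof.
have := connection_difference_sym (smooth_vf_frame p u) (smooth_vf_frame p w).
by rewrite !frame_chart_at.
Qed.

Let hn : is_connection nabla := stat_connection hM.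
Let hns : is_connection nablas := dual_is_connection hdual.

Lemma difference_tensorD p (u w w' : tangent p) :
  difference_tensor u (w + w') = difference_tensor u w + difference_tensor u w'.
Proof.
rewrite /difference_tensor.
have -> : frame (chart_at p) (w + w')
  = (fun q => frame (chart_at p) w q + frame (chart_at p) w' q).
  by apply/funext => q; exact: frameD.
have [s s'] := (smooth_vf_frame p w, smooth_vf_frame p w').
by rewrite (conn_add hn u s s') (conn_add hns u s s') opprD addrACA.
Qed.

Lemma difference_tensorZ p a (u w : tangent p) :
  difference_tensor u (a *: w) = a *: difference_tensor u w.
Proof.
rewrite /difference_tensor.
have -> : frame (chart_at p) (a *: w) = (fun q => a *: frame (chart_at p) w q).
  by apply/funext => q; exact: frameZ.
have s := smooth_vf_frame p w.
by rewrite (connZr hn u a s) (connZr hns u a s) scalerBr.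
Qed.

End AmbientDifference.

Section Pullback.
Context {R : realType} {n : nat} {Mt : manifold R n.+1} {M : manifold R n}.
Context {iota : M -> Mt} {gt : form_field Mt}.
Context {nablat nablats : @connection R n.+1 Mt} {D Ds : connection_along iota}.
Hypotheses (sf : smooth_map iota).
Hypotheses (hg : is_metric gt) (hdual : dual_connection gt nablat nablats).
Hypotheses (hD : pullback_connection nablat D) (hDs : pullback_connection nablats Ds).
Implicit Types (V : vfield_along iota).

Let cD := pullback_is_connection hD.
Let cDs := pullback_is_connection hDs.

(** On restricted frame fields [D] is given by [nablat], for which [F] is parallel; additivity, the
    Leibniz rule and linearity of [F] extend this to all sections. *)
Lemma pullback_parallel (F : endo_field Mt) V p (v : tangent p) :
  is_tensor11 F ->
  (forall x (X Y : vfield Mt), smooth_vf X x -> smooth_vf Y x ->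
    nablat (X x) (fun q => F q (Y q)) = F x (nablat (X x) Y)) ->
  smooth_along V p -> D v (fun q => F (iota q) (V q)) = F (iota p) (D v V).
Proof.
move=> hF parF.
pose P V := D v (fun q => F (iota q) (V q)) = F (iota p) (D v V).
apply: (section_ind (P := P)) sf.1 _ _ _ _ V => [V V' sV VV'|V V' sV sV'|h V sh sV|w].
- rewrite /P (near_eq_conn cD v sV VV') => <-; apply: (near_eq_conn cD).
    exact: smooth_along_tensor.
  by apply: filterS VV' => q ->.
- rewrite /P (conn_add cD v sV sV') (tensor11D hF) => <- <-.
  under eq_fun do rewrite (tensor11D hF).
  by rewrite (conn_add cD)//; exact: smooth_along_tensor.
- rewrite /P (conn_leibniz cD v sh sV) (tensor11D hF) !(tensor11Z hF) => <-.
  under eq_fun do rewrite (tensor11Z hF).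
  by rewrite (conn_leibniz cD)//; exact: smooth_along_tensor.
- rewrite /P; set E := frame _ w.
  have sE : smooth_vf E (iota p) by exact: smooth_vf_frame.
  have sFE : smooth_vf (fun q => F q (E q)) (iota p) by exact: tensor11_smooth.
  rewrite (pullback_eq hD v sE) (pullback_eq hD v sFE).
  have := parF _ _ _ (smooth_vf_frame (iota p) (dmap iota v)) sE.
  by rewrite frame_chart_at.
Qed.

(** Smoothness of the pairing is carried along because the sum and product rules for [dfun] require
    it at each step of the induction over sections. *)
Definition pullback_dual_at p (v : tangent p) V W :=
  smooth_fun (fun q => gt (V q) (W q)) p /\
  dfun v (fun q => gt (V q) (W q)) = gt (V p) (Ds v W) + gt (D v V) (W p).

Lemma pullback_dual_frame p (v : tangent p) w w' :
  pullback_dual_at v (fun q => frame (chart_at (iota p)) w (iota q))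
    (fun q => frame (chart_at (iota p)) w' (iota q)).
Proof.
set E := frame _ w; set E' := frame _ w'.
have sE : smooth_vf E (iota p) by exact: smooth_vf_frame.
have sE' : smooth_vf E' (iota p) by exact: smooth_vf_frame.
have sG : smooth_fun (fun x => gt (E x) (E' x)) (iota p) by exact: metric_smooth.
split; first exact: (msmooth_comp sf sG).
rewrite (pullback_eq hD v sE) (pullback_eq hDs v sE').
have := dual_eq hdual sE sE' (smooth_vf_frame (iota p) (dmap iota v)).
rewrite frame_chart_at => <-; exact: (mdiff_comp sf v sG).
Qed.

(** The two arguments are expanded in turn: here the first one against a frame field, and in
    [pullback_dual] the second one. *)
Lemma pullback_dual_frame_r p (v : tangent p) V w' : smooth_along V p ->
  pullback_dual_at v V (fun q => frame (chart_at (iota p)) w' (iota q)).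
Proof.
set W := fun q => frame _ w' (iota q).
apply: (section_ind (P := fun V => pullback_dual_at v V W)) sf.1 _ _ _ _ V =>
  [V V' sV VV' [sG e]|V V' sV sV' [sG e] [sG' e']|h V sh sV [sG e]|w].
- have GG' : \forall q \near p, gt (V q) (W q) = gt (V' q) (W q).
    by apply: filterS VV' => q ->.
  split; first exact: near_eq_msmooth GG' sG.
  apply: etrans (near_eq_mdiff v GG' sG) _.
  by apply: etrans e _; rewrite (near_eq_conn cD v sV VV') (nbhs_singleton VV').
- split; first by under eq_fun do rewrite (metricDl hg); exact: msmoothD.
  rewrite (conn_add cD v sV sV') !(metricDl hg) addrACA -e -e'.
  under eq_fun do rewrite (metricDl hg); exact: mdiffD.
- split; first by under eq_fun do rewrite (metricZl hg); exact: msmooth_scale.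
  rewrite (conn_leibniz cD v sh sV) !(metricDl hg) !(metricZl hg).
  rewrite addrCA -mulrDr -e.
  under eq_fun do rewrite (metricZl hg); exact: mdiff_scale.
- exact: pullback_dual_frame.
Qed.

Lemma pullback_dual p (v : tangent p) V W :
  smooth_along V p -> smooth_along W p -> pullback_dual_at v V W.
Proof.
move=> sV.
apply: (section_ind (P := fun W => pullback_dual_at v V W)) sf.1 _ _ _ _ W =>
  [W W' sW WW' [sG e]|W W' sW sW' [sG e] [sG' e']|h W sh sW [sG e]|w].
- have GG' : \forall q \near p, gt (V q) (W q) = gt (V q) (W' q).
    by apply: filterS WW' => q ->.
  split; first exact: near_eq_msmooth GG' sG.
  apply: etrans (near_eq_mdiff v GG' sG) _.
  by apply: etrans e _; rewrite (near_eq_conn cDs v sW WW') (nbhs_singleton WW').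
- split; first by under eq_fun do rewrite (metricDr hg); exact: msmoothD.
  rewrite (conn_add cDs v sW sW') !(metricDr hg) addrACA -e -e'.
  under eq_fun do rewrite (metricDr hg); exact: mdiffD.
- split; first by under eq_fun do rewrite (metricZr hg); exact: msmooth_scale.
  rewrite (conn_leibniz cDs v sh sW) !(metricDr hg) !(metricZr hg).
  rewrite -addrA -mulrDr -e.
  under eq_fun do rewrite (metricZr hg); exact: mdiff_scale.
- exact: pullback_dual_frame_r.
Qed.

(** Both Leibniz rules have the same derivative term, which cancels; on frame fields the difference
    is the ambient one. *)
Lemma pullback_difference p (v : tangent p) V :
  statistical_manifold gt nablat -> smooth_along V p ->
  Ds v V - D v V
  = difference_tensor (nabla := nablat) (nablas := nablats) (dmap iota v) (V p).
Proof.
move=> hM.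
set K := difference_tensor _.
pose P V := Ds v V - D v V = K (V p).
apply: (section_ind (P := P)) sf.1 _ _ _ _ V => [V V' sV VV'|V V' sV sV'|h V sh sV|w].
- rewrite /P (near_eq_conn cD v sV VV') (near_eq_conn cDs v sV VV') => ->.
  by rewrite (nbhs_singleton VV').
- rewrite /P (conn_add cD v sV sV') (conn_add cDs v sV sV').
  by rewrite /K (difference_tensorD hM hdual) => <- <-; rewrite opprD addrACA.
- rewrite /P (conn_leibniz cD v sh sV) (conn_leibniz cDs v sh sV).
  rewrite /K (difference_tensorZ hM hdual) => <-.
  by rewrite opprD addrACA subrr add0r scalerBr.
- rewrite /P; set E := frame _ w.
  have sE : smooth_vf E (iota p) by exact: smooth_vf_frame.
  rewrite (pullback_eq hD v sE) (pullback_eq hDs v sE).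
  by rewrite /K /difference_tensor /E frame_chart_at.
Qed.

End Pullback.

(** * Hypersurfaces *)

(* For orthogonal V and W the function gt(V, W) vanishes, so that no second
   derivatives of functions, hence no bracket of X and Y, enter the duality of
   the curvatures. *)
Section OrthogonalSections.
Context {R : realType} {n : nat} {Mt : manifold R n.+1} {M : manifold R n}.
Context {iota : M -> Mt} {gt : form_field Mt}.
Context {nablat nablats : @connection R n.+1 Mt} {D Ds : connection_along iota}.
Hypotheses (sf : smooth_map iota).
Hypotheses (hg : is_metric gt) (hdual : dual_connection gt nablat nablats).
Hypotheses (hD : pullback_connection nablat D) (hDs : pullback_connection nablats Ds).
Variables (V W : vfield_along iota).
Hypotheses (sV : forall p, smooth_along V p) (sW : forall p, smooth_along W p).
Hypothesis VW0 : forall p, gt (V p) (W p) = 0.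

Lemma orthogonal_dual p (v : tangent p) : gt (V p) (Ds v W) = - gt (D v V) (W p).
Proof.
have [_ e] := pullback_dual sf hg hdual hD hDs v (sV p) (sW p).
apply/eqP; rewrite -addr_eq0 -e; apply/eqP.
by under eq_fun do rewrite VW0; exact: mdiff_cst.
Qed.

(** This is [orthogonal_dual] in the direction [Y], differentiated along [X]. The two mixed terms
    together are symmetric in [X] and [Y], so they drop out of the curvature. *)
Lemma orthogonal_dual2 (X Y : vfield M) p :
  (forall p, smooth_vf X p) -> (forall p, smooth_vf Y p) ->
  gt (V p) (Ds (X p) (fun q => Ds (Y q) W))
  = - (gt (D (X p) (fun q => D (Y q) V)) (W p)
       + gt (D (Y p) V) (Ds (X p) W) + gt (D (X p) V) (Ds (Y p) W)).
Proof.
move=> sX sY.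
have sDs : smooth_along (f := iota) (fun q => Ds (Y q) W) p.
  exact: conn_smooth (pullback_is_connection hDs) _ _ _ (sY p) (sW p).
have sD : smooth_along (f := iota) (fun q => D (Y q) V) p.
  exact: conn_smooth (pullback_is_connection hD) _ _ _ (sY p) (sV p).
have [s1 e1] := pullback_dual sf hg hdual hD hDs (X p) (sV p) sDs.
have [s2 e2] := pullback_dual sf hg hdual hD hDs (X p) sD (sW p).
have e0 : mdiff (fun q => gt (V q) (Ds (Y q) W) + gt (D (Y q) V) (W q)) (X p) = 0.
  by under eq_fun do rewrite orthogonal_dual addNr; exact: mdiff_cst.
have e : 0 = dfun (X p) _ + dfun (X p) _ := etrans (esym e0) (mdiffD (X p) s1 s2).
have /esym/eqP := etrans e (congr2 +%R e1 e2).
by rewrite -addrA addr_eq0 => /eqP ->; ring.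
Qed.

End OrthogonalSections.

(** * Derivatives of the shape operators and the curvature on the normal *)

Section ShapePairing.
Context {R : realType} {n : nat} {Mt : manifold R n.+1} {M : manifold R n}.
Context {iota : M -> Mt} {gt : form_field Mt}.
Hypothesis hg : is_metric gt.
Context {D : connection_along iota} {N : vfield_along iota}.
Context {nabla : @connection R n M} {A : endo_field M} {kappa : one_form M}.
Hypotheses (hD : is_connection_along D) (hA : is_tensor11 A)
  (sN : forall p, smooth_along N p).
Hypothesis skappa : forall p (Y : vfield M), smooth_vf Y p ->
  smooth_fun (fun q => kappa (Y q)) p.
Hypothesis hgauss : forall p (v : tangent p) (Y : vfield M), smooth_vf Y p ->
  exists a : R,
    D v (fun q => dmap iota (Y q)) = dmap iota (nabla v Y) + a *: N p.
Hypothesis hweingarten : forall p (v : tangent p),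
  D v N = - dmap iota (A v) + kappa v *: N p.
Variables (X Y : vfield M).
Hypotheses (sX : forall p, smooth_vf X p) (sY : forall p, smooth_vf Y p).

Lemma dmap_shape p (v : tangent p) :
  dmap iota (A v) = kappa v *: N p + -1 *: D v N.
Proof. by rewrite hweingarten scaleN1r opprD opprK addrC -addrA addNr addr0. Qed.

(** Weingarten gives the image of [A Y] as [kappa Y *: N - D Y N]; this is differentiated along [X]
    and compared with Gauss. Pairing with [u] orthogonal to [N] removes the normal terms, so
    [hgauss] leaves their coefficient unspecified. *)
Lemma shape_pairing p (u : tangent (iota p)) : gt (N p) u = 0 ->
  gt (dmap iota (nabla_shape nabla A kappa X Y p)) u
  = gt (D (nabla (X p) Y) N) u - gt (D (X p) (fun q => D (Y q) N)) u
    + kappa (Y p) * gt (D (X p) N) u + kappa (X p) * gt (D (Y p) N) u.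
Proof.
move=> Nu.
have [a] := hgauss (X p) (tensor11_smooth hA (sY p)).
have -> : (fun q => dmap iota (A (Y q)))
    = (fun q => kappa (Y q) *: N q + -1 *: D (Y q) N).
  by apply/funext => q; exact: dmap_shape.
have sD : smooth_along (f := iota) (fun q => D (Y q) N) p.
  exact: conn_smooth hD _ _ _ (sY p) (sN p).
have s1 : smooth_fun (fun _ : M => -1 : R) p by exact: msmooth_cst.
have sk := skappa (sY p).
rewrite (conn_add hD (X p) (smooth_along_scale sk (sN p)) (smooth_along_scale s1 sD)).
rewrite (connZr hD (X p) (-1) sD) (conn_leibniz hD (X p) sk (sN p)).
move=> /(congr1 (fun w => gt w u)).
rewrite !(metricDl hg) !(metricZl hg) Nu !mulr0 addr0 add0r => e.
rewrite /nabla_shape !dmapD !dmapN dmapZ !dmap_shape.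
rewrite !(metricDl hg, metricNl hg, metricZl hg) Nu -e.
ring.
Qed.

End ShapePairing.

(** The [kappa] terms of [shape_pairing] are symmetric in [X] and [Y] and cancel. What remains is
    minus the curvature of [D] on [N], with [nabla_X Y - nabla_Y X] in place of the bracket. *)
Lemma shape_pairing_antisym (R : realType) (n : nat) (Mt : manifold R n.+1)
    (M : manifold R n) (iota : M -> Mt) (gt : form_field Mt)
    (D : connection_along iota) (N : vfield_along iota)
    (nabla : @connection R n M) (A : endo_field M) (kappa : one_form M)
    (X Y : vfield M) p (u : tangent (iota p)) :
  is_metric gt -> is_connection_along D -> is_tensor11 A ->
  (forall p, smooth_along N p) ->
  (forall p (Y : vfield M), smooth_vf Y p -> smooth_fun (fun q => kappa q (Y q)) p) ->
  (forall p (v : tangent p) (Y : vfield M), smooth_vf Y p -> exists a : R,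
     D p v (fun q => dmap iota (Y q)) = dmap iota (nabla p v Y) + a *: N p) ->
  (forall p (v : tangent p), D p v N = - dmap iota (A p v) + kappa p v *: N p) ->
  (forall p, smooth_vf X p) -> (forall p, smooth_vf Y p) ->
  gt (iota p) (N p) u = 0 ->
  gt (iota p) (dmap iota (nabla_shape nabla A kappa X Y p)) u
  - gt (iota p) (dmap iota (nabla_shape nabla A kappa Y X p)) u
  = gt (iota p) (D p (nabla p (X p) Y - nabla p (Y p) X) N) u
    - gt (iota p) (D p (X p) (fun q => D q (Y q) N)) u
    + gt (iota p) (D p (Y p) (fun q => D q (X q) N)) u.
Proof.
move=> hg hD hA sN sk hG hW sX sY Nu.
rewrite !(shape_pairing hg hD hA sN sk hG hW) // (connDl hD)// (connNl hD)//.
by rewrite (metricDl hg) (metricNl hg); ring.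
Qed.
Unset Implicit Arguments.
Set Strict Implicit.

Theorem proposition5p7 (R : realType) (n : nat)
  (* the locally product-like statistical manifold, with F^* and the dual connection *)
  (Mt : manifold R n.+1) (gt : form_field Mt) (nablat nablats : @connection R n.+1 Mt)
  (F Fs : endo_field Mt)
  (hMt : locally_product_like gt nablat F Fs)
  (hdual : dual_connection gt nablat nablats)
  (* the tangential hypersurface *)
  (M : manifold R n) (iota : M -> Mt) (hiota : immersion iota)
  (N : vfield_along iota) (hN : unit_normal gt N)
  (htan : tangential F Fs N)
  (xi xis : vfield M)
  (hxi : forall p, dmap iota (xi p) = F (iota p) (N p))
  (hxis : forall p, dmap iota (xis p) = Fs (iota p) (N p))
  (* the induced objects, given by the Gauss and Weingarten formulas *)
  (D Ds : connection_along iota)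
  (hD : pullback_connection nablat D) (hDs : pullback_connection nablats Ds)
  (nabla nablas : @connection R n M) (A As : endo_field M) (kappa : one_form M)
  (hnabla : is_connection nabla) (hnablas : is_connection nablas)
  (hA : is_tensor11 A) (hAs : is_tensor11 As) (hkappa : is_one_form kappa)
  (hGW : gauss_weingarten gt D Ds N nabla nablas A As kappa) :
  let g := induced_metric iota gt in
  let eta : one_form M := fun p v => g p v (xi p) in
  let etas : one_form M := fun p v => g p v (xis p) in
  forall X Y : vfield M,
    (forall p, smooth_vf X p) -> (forall p, smooth_vf Y p) ->
    forall p : M,
      eta p (nabla_shape_dual nablas As kappa X Y p)
      - eta p (nabla_shape_dual nablas As kappa Y X p)
      = - etas p (nabla_shape nabla A kappa X Y p)
        + etas p (nabla_shape nabla A kappa Y X p).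
Proof.


move=> g eta etas X Y sX sY p.
have hS := lpl_statistical hMt; have hg := stat_metric hS.
have sf := hiota.1; have sN := normal_smooth hN.
have hF := lpl_tensor hMt.
have cD := pullback_is_connection hD; have cDs := pullback_is_connection hDs.
pose FN : vfield_along iota := fun q => F (iota q) (N q).
have sFN q : smooth_along FN q by exact: smooth_along_tensor.
have NFN q : gt (iota q) (N q) (FN q) = 0 by rewrite /FN -hxi (normal_orthogonal hN).
have FNN q : gt (iota q) (FN q) (N q) = 0 by rewrite (Defs.metric_sym hg).
have NFsN : gt (iota p) (N p) (Fs (iota p) (N p)) = 0.
  by rewrite -hxis (normal_orthogonal hN).
have parF q (v : tangent q) (V : vfield_along iota) : smooth_along V q ->
    D q v (fun r => F (iota r) (V r)) = F (iota q) (D q v V).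
  move=> sV; apply: (pullback_parallel sf hD v hF _ sV) => x Z Z' sZ sZ'.
  exact: (lpl_parallel hMt sZ sZ').
have sk q (Z : vfield M) : smooth_vf Z q -> smooth_fun (fun r => kappa r (Z r)) q.
  exact: one_form_smooth.
(* With [- kappa] the dual formulas take the shape of the original ones, so [shape_pairing_antisym]
   applies to both connections. *)
pose kappas : one_form M := fun q v => - kappa q v.
have sks q (Z : vfield M) : smooth_vf Z q -> smooth_fun (fun r => kappas r (Z r)) q.
  move=> /sk sZ; have s1 : smooth_fun (fun _ : M => -1 : R) q by exact: msmooth_cst.
  apply: near_eq_msmooth (msmooth_scale s1 sZ).
  by apply: filterE => r; exact: scaleN1r.
have shapeE Z Z' : nabla_shape_dual nablas As kappa Z Z' p
    = nabla_shape nablas As kappas Z Z' p.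
  by rewrite /nabla_shape /nabla_shape_dual /kappas scaleNr opprK.
have hG q (v : tangent q) (Z : vfield M) : smooth_vf Z q -> exists a : R,
    D q v (fun r => dmap iota (Z r)) = dmap iota (nabla q v Z) + a *: N q.
  by move=> sZ; eexists; exact: (gauss hGW v sZ).
have hGs q (v : tangent q) (Z : vfield M) : smooth_vf Z q -> exists a : R,
    Ds q v (fun r => dmap iota (Z r)) = dmap iota (nablas q v Z) + a *: N q.
  by move=> sZ; eexists; exact: (gauss_dual hGW v sZ).
have hW := weingarten hGW.
have hWs q (v : tangent q) :
    Ds q v N = - dmap iota (As q v) + kappas q v *: N q.
  by rewrite (weingarten_dual hGW) /kappas scaleNr.
(* The symmetric difference tensor, evaluated on the images of [X] and [Y], is split by the Gauss
   formulas; its tangential part is this identity. *)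
have torsion : nablas p (X p) Y - nablas p (Y p) X
             = nabla p (X p) Y - nabla p (Y p) X.
  have sdX := smooth_along_dmap sf (sX p).
  have sdY := smooth_along_dmap sf (sY p).
  have := pullback_difference sf hdual hD hDs (X p) hS sdY.
  rewrite (difference_tensor_sym hS hdual).
  rewrite -(pullback_difference sf hdual hD hDs (Y p) hS sdX).
  have [a ->] := hGs p (X p) Y (sY p); have [b ->] := hG p (X p) Y (sY p).
  have [c ->] := hGs p (Y p) X (sX p); have [d ->] := hG p (Y p) X (sX p).
  move=> K; apply: (hiota.2 p); apply: (metric_nondegenerate hg) => w.
  (* Pairing with [N] equates the normal coefficients, [a - b = c - d]; pairing with an arbitrary
     [w] then leaves the tangential parts. *)
  have gK w' := congr1 (fun z => gt (iota p) w' z) K.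
  have := gK (N p); have := gK w.
  rewrite !dmapD !dmapN !(metricDr hg, metricNr hg, metricZr hg).
  rewrite !(normal_orthogonal hN) (normal_unit hN) => Kw KN.
  have KN' : a - b = c - d by clear -KN; lra.
  have : (a - b) * gt (iota p) w (N p) = (c - d) * gt (iota p) w (N p) by rewrite KN'.
  by rewrite !mulrBl; clear -Kw; lra.
(* An equality of sections, so that [F] can be pulled out of a second derivative of [FN] by using
   [parF] again. *)
have DF Z : (forall q, smooth_vf Z q) ->
    (fun q => D q (Z q) FN) = (fun q => F (iota q) (D q (Z q) N)).
  by move=> sZ; apply/funext => q; exact: parF.
have sDN Z : (forall q, smooth_vf Z q) ->
    smooth_along (f := iota) (fun q => D q (Z q) N) p.
  by move=> sZ; exact: conn_smooth cD _ _ _ (sZ p) (sN p).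
have e1 := orthogonal_dual2 sf hg hdual hD hDs sFN sN FNN p sX sY.
have e2 := orthogonal_dual2 sf hg hdual hD hDs sFN sN FNN p sY sX.
have e3 := orthogonal_dual sf hg hdual hD hDs sFN sN FNN.
rewrite !shapeE.
have es := shape_pairing_antisym hg cDs hAs sN sks hGs hWs sX sY (NFN p).
have e := shape_pairing_antisym hg cD hA sN sk hG hW sX sY NFsN.
move: es e; rewrite torsion /eta /etas /g /induced_metric hxi hxis.
set T := nabla p (X p) Y - _ => es e.
(* The bracket term of the curvature duality, with [T] standing for the bracket. *)
have e4 : gt (iota p) (FN p) (Ds p T N) = - gt (iota p) (D p T N) (Fs (iota p) (N p)).
  by rewrite e3 (parF _ _ _ (sN p)) (lpl_adjoint hMt).
move: e1 e2 e4; rewrite (DF _ sX) (DF _ sY) (parF _ _ _ (sDN _ sX)) (parF _ _ _ (sDN _ sY)).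
(* Moving [F] across the metric leaves pairings with [Fs N], as in [e]. In the difference of the two
   second-order identities the mixed terms cancel, and the rest is linear. *)
rewrite !(Defs.metric_sym hg (FN p)) !(lpl_adjoint hMt).
rewrite -/(FN p) in es *; move: es e; clear.
lra.
Qed.
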